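(* Let $n\ge 13$ and let $\mathcal{F}$ be a family of subsets of $[n]$. Assume that there are no 4 different sets $A,B,C,D\in\mathcal{F}$ such that $A\subset C$, $A\subset D$, $B\subset C$, $B\subset D$, and either $|A|=|B|$ or $|C|=|D|$. Then $|\mathcal{F}|\le\Sigma(n,2)$.
   Context: $[n]=\{1,2,\dots,n\}$. For integers $n,k$, $\Sigma(n,k)=\sum_{i=\lceil\frac{n-k}{2}\rceil}^{\lceil\frac{n+k}{2}\rceil-1}\binom{n}{i}$ denotes the sum of the $k$ largest binomial coefficients $\binom{n}{i}$. *)

(* Defs.v *)
From mathcomp Require Import all_boot.

Set Implicit Arguments.
Unset Strict Implicit.
Unset Printing Implicit Defensive.

(* [uphalf m] is the ceiling of m/2; the upper bound of the sum is exclusive.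
   When k > n the truncated difference n - k only drops indices i < 0, for
   which the binomial coefficient vanishes. *)
Definition Sigma (n k : nat) : nat :=
  \sum_(uphalf (n - k) <= i < uphalf (n + k)) 'C(n, i).

(* Main.v *)
(* Call a member of F middle if it lies strictly between two members of F. A
   middle set X has at most one F-subset and at most one F-superset on each
   level, so, once the empty and full sets are discarded, a random maximal chain
   through X meets on average at most g(|X|) + g(n - |X|) members of F other than
   X, where g(k) = sum_(0 < y < k) 1 / C(k, y). For n >= 13 this is less than 1,
   while a chain without middle sets meets F at most twice; averaging over chains
   gives the LYM-type inequality sum_(X in F) 1 / C(n, |X|) <= 2, hence the bound.
   If the empty or the full set belongs to F, a chain without middle sets meets
   the rest of F at most once, and the improved right-hand side 1 + 99/100 leaves
   room for the two discarded sets. *)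
Require Import Defs.
From mathcomp Require Import all_boot all_order all_algebra all_fingroup.
From mathcomp Require Import ring lra zify.

Set Implicit Arguments.
Unset Strict Implicit.
Unset Printing Implicit Defensive.

Import Order.TTheory GRing.Theory Num.Theory.
Local Open Scope ring_scope.

(** * Sums of reciprocals of binomial coefficients *)

Definition inv_bin_sum (k : nat) : rat := \sum_(1 <= y < k) ('C(k, y)%:R)^-1.

Lemma bin_natr_neq0 n k : (k <= n)%N -> 'C(n, k)%:R != 0 :> rat.
Proof. by move=> le_kn; rewrite pnatr_eq0 -lt0n bin_gt0. Qed.

(** Over the common denominator (n+1) C(n,k) the two reciprocals have numerators n+1-k and k+1. *)
Lemma inv_binS n k : (k <= n)%N ->
  ('C(n.+1, k)%:R)^-1 + ('C(n.+1, k.+1)%:R)^-1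
    = n.+2%:R / n.+1%:R * ('C(n, k)%:R)^-1 :> rat.
Proof.
move=> le_kn.
have e1 : (n.+1)%:R * 'C(n, k)%:R = (k.+1)%:R * 'C(n.+1, k.+1)%:R :> rat.
  by rewrite -!natrM mul_bin_diag.
have e2 : (n.+1)%:R * 'C(n, k)%:R = (n.+1 - k)%:R * 'C(n.+1, k)%:R :> rat.
  by rewrite -!natrM mul_bin_down.
have b0 := bin_natr_neq0 le_kn.
have b1 := @bin_natr_neq0 n.+1 k.+1 le_kn.
have b2 := @bin_natr_neq0 n.+1 k (leqW le_kn).
have n0 : n.+1%:R != 0 :> rat by rewrite pnatr_eq0.
have -> : ('C(n.+1, k)%:R)^-1 = (n.+1 - k)%:R / (n.+1%:R * 'C(n, k)%:R) :> rat.
  by rewrite e2 invfM mulrA divff ?mul1r // pnatr_eq0; lia.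
have -> : ('C(n.+1, k.+1)%:R)^-1 = k.+1%:R / (n.+1%:R * 'C(n, k)%:R) :> rat.
  by rewrite e1 invfM mulrA divff ?mul1r // pnatr_eq0.
rewrite -mulrDl -natrD invfM mulrA; congr (_%:R / _ / _); lia.
Qed.

(** Summing [inv_binS] over row k counts every inner term of row k+1 twice and each end once; the
    two ends of a full row contribute 1 each. *)
Lemma inv_bin_sumS k : (0 < k)%N ->
  inv_bin_sum k.+1 = (k.+1%:R)^-1 + k.+2%:R / (2 * k.+1%:R) * inv_bin_sum k.
Proof.
move=> k_gt0; rewrite /inv_bin_sum.
have n0 : k.+1%:R != 0 :> rat by rewrite pnatr_eq0.
have full m : (0 < m)%N ->
    \sum_(0 <= y < m.+1) ('C(m, y)%:R)^-1 = 2 + inv_bin_sum m :> rat.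
  move=> m0; rewrite big_nat_recr //= big_ltn // bin0 binn /inv_bin_sum.
  by rewrite invr1; ring.
have := full _ k_gt0; have := full _ (ltn0Sn k).
rewrite -!/(inv_bin_sum _).
set gS := inv_bin_sum k.+1; set g := inv_bin_sum k => eS e.
have : \sum_(0 <= y < k.+1) (('C(k.+1, y)%:R)^-1 + ('C(k.+1, y.+1)%:R)^-1)
   = k.+2%:R / k.+1%:R * (2 + g) :> rat.
  rewrite -e mulr_sumr; apply: eq_big_nat => i /andP[_ lti].
  exact: inv_binS.
have eS1 : \sum_(0 <= y < k.+1) ('C(k.+1, y)%:R)^-1 = 1 + gS :> rat.
  by move: eS; rewrite big_nat_recr //= binn invr1; lra.
have eS2 : \sum_(0 <= y < k.+1) ('C(k.+1, y.+1)%:R)^-1 = 1 + gS :> rat.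
  by move: eS; rewrite big_nat_recl //= bin0 invr1; lra.
rewrite big_split /= eS1 eS2.
have -> : k.+2%:R = k.+1%:R + 1 :> rat by rewrite -natr1.
move: n0; rewrite /gS /g.
move: (k.+1%:R : rat) (inv_bin_sum k.+1) (inv_bin_sum k) => a s1 s0 n0 E.
have -> : s1 = ((a + 1) / a * (2 + s0) - 2) / 2 by rewrite -E; field.
by field.
Qed.

Lemma inv_bin_sum1 : inv_bin_sum 1 = 0.
Proof. by rewrite /inv_bin_sum big_geq. Qed.

(** The threshold 2/k is the fixed point of the recursion step, so this bound is what makes the
    sequence decrease from 3 on. *)
Lemma inv_bin_sum_ge k : (3 <= k)%N -> 2 / k%:R <= inv_bin_sum k.
Proof.
elim: k => // k IH; rewrite ltnS leq_eqVlt => /predU1P[<-|k_ge3].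
  by rewrite !(inv_bin_sumS (ltn0Sn _)) inv_bin_sum1; lra.
have {IH} := IH k_ge3; rewrite inv_bin_sumS; last lia.
have -> : k.+2%:R = k%:R + 2 :> rat by rewrite -natrD addn2.
have -> : k.+1%:R = k%:R + 1 :> rat by rewrite natr1.
have : 3 <= k%:R :> rat by rewrite ler_nat.
move: (k%:R : rat) (inv_bin_sum k) => a g a3 ge.
have -> : 2 / (a + 1) = (a + 1)^-1 + (a + 1)^-1 by field; lra.
rewrite lerD2l.
have : (a + 2) / (2 * (a + 1)) * (2 / a) <= (a + 2) / (2 * (a + 1)) * g.
  by apply: ler_wpM2l => //; apply: divr_ge0; lra.
apply: le_trans.
have -> : (a + 2) / (2 * (a + 1)) * (2 / a) = (a + 1)^-1 + 2 / (a * (a + 1)).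
  by field; apply/andP; split; lra.
by rewrite lerDl; apply: divr_ge0 => //; apply: mulr_ge0; lra.
Qed.

Lemma inv_bin_sumS_le k : (3 <= k)%N -> inv_bin_sum k.+1 <= inv_bin_sum k.
Proof.
move=> k_ge3; have := inv_bin_sum_ge k_ge3; rewrite inv_bin_sumS; last lia.
have -> : k.+2%:R = k%:R + 2 :> rat by rewrite -natrD addn2.
have -> : k.+1%:R = k%:R + 1 :> rat by rewrite natr1.
have : 3 <= k%:R :> rat by rewrite ler_nat.
move: (k%:R : rat) (inv_bin_sum k) => a g a3 ge.
rewrite -subr_ge0.
have -> : g - ((a + 1)^-1 + (a + 2) / (2 * (a + 1)) * g)
   = a / (2 * (a + 1)) * (g - 2 / a) by field; apply/andP; split; lra.
by apply: mulr_ge0; [apply: divr_ge0 | ]; lra.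
Qed.

Lemma inv_bin_sum_le j k : (3 <= j)%N -> (j <= k)%N ->
  inv_bin_sum k <= inv_bin_sum j.
Proof.
move=> j_ge3; elim: k => [|k IH]; first lia.
rewrite leq_eqVlt => /predU1P[->//|]; rewrite ltnS => le_jk.
by apply: le_trans (IH le_jk); apply: inv_bin_sumS_le; apply: leq_trans le_jk.
Qed.

(* At [n = 13] the maximum, attained at [x = 4], is 62/63;
   for [n = 12] even the bound 1 fails at [x = 4]. *)
Lemma inv_bin_sum_pair x y : (0 < x)%N -> (0 < y)%N -> (13 <= x + y)%N ->
  inv_bin_sum x + inv_bin_sum y <= 99 / 100.
Proof.
wlog le_xy : x y / (x <= y)%N.
  by move=> W x0 y0 xy; case/orP: (leq_total x y) => ?; [|rewrite addrC];
     apply: W => //; rewrite addnC.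
move=> x_gt0 y_gt0 le13.
(* If both arguments are at least 7, twice the value at 7, about 0.88, suffices. Otherwise 13 - x is
   at least 7 and only the pairs (x, 13 - x) with x at most 6 remain. *)
have [x_ge7|x_le6] := leqP 7 x.
  have := inv_bin_sum_le (isT : 3 <= 7)%N x_ge7.
  have := inv_bin_sum_le (isT : 3 <= 7)%N (leq_trans x_ge7 le_xy).
  rewrite !(inv_bin_sumS (ltn0Sn _)) inv_bin_sum1; lra.
have le_y : inv_bin_sum y <= inv_bin_sum (13 - x) by apply: inv_bin_sum_le; lia.
have x_in : x \in [:: 1; 2; 3; 4; 5; 6]%N by rewrite !inE; lia.
have rec k :
    inv_bin_sum k.+2 = (k.+2%:R)^-1 + k.+3%:R / (2 * k.+2%:R) * inv_bin_sum k.+1.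
  exact: inv_bin_sumS.
have g2 : inv_bin_sum 2 = 1 / 2 by rewrite rec inv_bin_sum1; lra.
have g3 : inv_bin_sum 3 = 2 / 3 by rewrite rec g2; lra.
have g4 : inv_bin_sum 4 = 2 / 3 by rewrite rec g3; lra.
have g5 : inv_bin_sum 5 = 3 / 5 by rewrite rec g4; lra.
have g6 : inv_bin_sum 6 = 31 / 60 by rewrite rec g5; lra.
(* From 7 on, rounded upper bounds are propagated instead of exact values; the tightest pair, 4 and
   9, still gives 2/3 + 32/100 < 99/100. *)
have g7 : inv_bin_sum 7 <= 44 / 100 by rewrite rec g6; lra.
have g8 : inv_bin_sum 8 <= 3725 / 10000 by rewrite rec; move: g7; clear; lra.
have g9 : inv_bin_sum 9 <= 32 / 100 by rewrite rec; move: g8; clear; lra.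
have g10 : inv_bin_sum 10 <= 28 / 100 by rewrite rec; move: g9; clear; lra.
have g11 : inv_bin_sum 11 <= 25 / 100 by rewrite rec; move: g10; clear; lra.
have g12 : inv_bin_sum 12 <= 25 / 100 by rewrite rec; move: g11; clear; lra.
move: x_in; rewrite !inE => /or4P[||| /or3P[]] /eqP x_eq;
  move: le_y; rewrite x_eq !subSS subn0.
- by rewrite inv_bin_sum1; move: g12; clear; lra.
- by rewrite g2; move: g11; clear; lra.
- by rewrite g3; move: g10; clear; lra.
- by rewrite g4; move: g9; clear; lra.
- by rewrite g5; move: g8; clear; lra.
- by rewrite g6; move: g7; clear; lra.
Qed.

(** * Maximal chains as permutations *)

(* A permutation [s] encodes the maximal chain of the sets [s @: {0, ..., k-1}]. *)
Definition on_chain n (s : 'S_n) (X : {set 'I_n}) : bool :=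
  s @: [set i : 'I_n | (i < #|X|)%N] == X.

Lemma card_ord_lt n k : (k <= n)%N -> #|[set i : 'I_n | (i < k)%N]| = k.
Proof.
move=> le_kn; have -> : [set i : 'I_n | (i < k)%N] = widen_ord le_kn @: setT.
  apply/setP=> i; rewrite inE; apply/idP/imsetP => [lt_ik|[j _ ->]];
    last exact: (ltn_ord j).
  by exists (Ordinal lt_ik) => //; apply: val_inj.
rewrite card_imset ?cardsT ?card_ord // => i j /(congr1 val) /= ?.
exact: val_inj.
Qed.

Lemma on_chain_sub n (s : 'S_n) X Y :
  on_chain s X -> on_chain s Y -> (#|X| <= #|Y|)%N -> X \subset Y.
Proof.
move=> /eqP sX /eqP sY le_XY; rewrite -sX -sY; apply/imsetS/subsetP => i.
by rewrite !inE => lt_i; apply: leq_trans le_XY.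
Qed.

Lemma on_chain_level n (s : 'S_n) k : (k <= n)%N ->
  exists2 X : {set 'I_n}, on_chain s X & #|X| = k.
Proof.
move=> le_kn; exists (s @: [set i : 'I_n | (i < k)%N]).
  by rewrite /on_chain card_imset ?card_ord_lt //; apply: perm_inj.
by rewrite card_imset ?card_ord_lt //; apply: perm_inj.
Qed.

Lemma on_chainM n (s p : 'S_n) (X : {set 'I_n}) :
  on_chain (s * p)%g (p @: X) = on_chain s X.
Proof.
rewrite /on_chain (card_imset _ (@perm_inj _ p)).
have -> : (s * p)%g @: [set i : 'I_n | (i < #|X|)%N]
    = p @: (s @: [set i : 'I_n | (i < #|X|)%N]).
  by rewrite -imset_comp; apply: eq_imset => i; rewrite permM.
exact: (inj_eq (imset_inj (@perm_inj _ p))).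
Qed.

(** * Counting the chains through one or two sets *)

Lemma card_setC_ord n (A : {set 'I_n}) : #|~: A| = (n - #|A|)%N.
Proof. by apply: (canRL (addKn _)); rewrite cardsC card_ord. Qed.

(** Colour each point by its membership in the two sets of the flag. Equal sizes give equal colour
    counts, so the two colourings differ by a permutation of the points. *)
Lemma flag_transitive n (X Y X' Y' : {set 'I_n}) :
  X \subset Y -> X' \subset Y' -> #|X| = #|X'| -> #|Y| = #|Y'| ->
  exists p : 'S_n, p @: X = X' /\ p @: Y = Y'.
Proof.
move=> sXY sXY' eX eY.
pose col (A B : {set 'I_n}) i := (i \in A, i \in B).
(* Inclusion rules out the colour of points in [A] but not in [B], which leaves three classes with
   sizes fixed by the cardinals. *)
have cnt (A B : {set 'I_n}) : A \subset B -> forall c,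
    count_mem c [tuple col A B i | i < n] =
    if c.2 then (if c.1 then #|A| else #|B| - #|A|)%N
    else (if c.1 then 0 else n - #|B|)%N.
  move=> sAB [a b]; rewrite count_map.
  transitivity #|[set i | col A B i == (a, b)]|.
    by rewrite cardsE cardE -size_filter val_ord_tuple {2}/enum_mem -enumT.
  have -> : [set i | col A B i == (a, b)] =
      (if a then A else ~: A) :&: (if b then B else ~: B).
    by apply/setP=> i; rewrite !inE xpair_eqE; case: a b => [] [];
       rewrite ?inE ?eqb_id ?eqbF_neg.
  case: a b => [] [] /=.
  - by rewrite (setIidPl sAB).
  - apply/eqP; rewrite cards_eq0 -subset0; apply/subsetP=> i.
    by rewrite !inE => /andP[/(subsetP sAB) ->].
  - by rewrite setIC -setDE cardsDS.
  - by rewrite -setCU (setUidPr sAB) card_setC_ord.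
have /tuple_permP[p ep] :
    perm_eq [tuple col X Y i | i < n] [tuple col X' Y' i | i < n].
  by apply/allP => c _ /=; apply/eqP; rewrite !cnt // eX eY.
have ecol i : col X Y i = col X' Y' (p i).
  have := congr1 (fun t : seq _ => nth (col X Y i) t i) ep.
  by rewrite -!tnth_nth !tnth_mktuple.
exists p; split; apply/eqP; rewrite eqEcard (card_imset _ (@perm_inj _ p)).
  rewrite eX leqnn andbT; apply/subsetP=> _ /imsetP[i iX ->].
  by have [<-] := ecol i.
rewrite eY leqnn andbT; apply/subsetP=> _ /imsetP[i iY ->].
by have [_ <-] := ecol i.
Qed.

(** The diagonal value [nchain X X] serves as the number of chains through [X] alone. *)
Definition nchain n (X Y : {set 'I_n}) : nat :=
  #|[set s : 'S_n | on_chain s X && on_chain s Y]|.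

Lemma nchainC n (X Y : {set 'I_n}) : nchain X Y = nchain Y X.
Proof. by apply: eq_card => s; rewrite !inE andbC. Qed.

(** Right multiplication by a permutation carrying one flag to the other is a bijection between the
    two sets of chains. *)
Lemma nchain_flag n (X Y X' Y' : {set 'I_n}) :
  X \subset Y -> X' \subset Y' -> #|X| = #|X'| -> #|Y| = #|Y'| ->
  nchain X Y = nchain X' Y'.
Proof.
move=> sXY sXY' eX eY; have [p [<- <-]] := flag_transitive sXY sXY' eX eY.
rewrite /nchain -(card_imset _ (mulIg p)); apply: eq_card => s; rewrite !inE.
apply/imsetP/idP => [[r]|]; first by rewrite inE => rX ->; rewrite !on_chainM.
rewrite -{1 2}(mulgKV p s) !on_chainM => h.
by exists (s * p^-1)%g; rewrite ?inE // mulgKV.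
Qed.

(** A chain through [X] has exactly one set on level [k], and that set satisfies [P]; hence the
    chains through [X] split into classes of size [c], one for each [Y]. *)
Lemma sum_nchain n (X : {set 'I_n}) (P : pred {set 'I_n}) (k c : nat) :
  (k <= n)%N ->
  (forall s (Y : {set 'I_n}), on_chain s X -> on_chain s Y -> #|Y| = k -> P Y) ->
  {in P, forall Y : {set 'I_n}, #|Y| = k} ->
  {in P, forall Y : {set 'I_n}, nchain X Y = c} ->
  nchain X X = (#|[set Y | P Y]| * c)%N.
Proof.
move=> le_kn chP cardP ncP.
have -> : (#|[set Y | P Y]| * c = \sum_(Y | P Y) nchain X Y)%N.
  by rewrite (eq_bigr (fun=> c)) // sum_nat_const cardsE.
under eq_bigr do rewrite /nchain -sum1_card big_mkcond /=.
rewrite exchange_big /= /nchain -sum1_card big_mkcond /=; apply: eq_bigr => s _.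
rewrite inE andbb; have [sX|nsX] := ifPn; last first.
  by rewrite big1 // => Y _; rewrite inE (negPf nsX).
have [Y sY cY] := on_chain_level s le_kn.
rewrite (bigD1 Y) /=; last exact: chP sX sY cY.
rewrite inE sX sY big1 ?addn0 // => Z /andP[PZ neZY].
rewrite inE sX; case: ifP => // sZ; case/eqP: neZY.
have cZ := cardP _ PZ.
by apply/eqP; rewrite eqEcard (on_chain_sub sZ sY) cY cZ leqnn.
Qed.

Lemma nchain_total n (X : {set 'I_n}) : (n`! = 'C(n, #|X|) * nchain X X)%N.
Proof.
have le_Xn : (#|X| <= n)%N by rewrite -[leqRHS]card_ord max_card.
have on0 (s : 'S_n) : on_chain s set0.
  by apply/eqP/setP => i; rewrite inE cards0; apply/imsetP=> -[j]; rewrite inE.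
(* The empty set lies on every chain, so all n! permutations count as chains through it, and they
   are split by their set of size [#|X|]. *)
transitivity (nchain (@set0 'I_n) set0).
  by rewrite -card_Sn; apply: eq_card => s; rewrite !inE !on0.
have -> : 'C(n, #|X|) = #|[set Y : {set 'I_n} | #|Y| == #|X|]|.
  by rewrite card_draws card_ord.
apply: (sum_nchain (k := #|X|)) => // [s Y _ _ <- //|Y /eqP //|Y /eqP eY].
transitivity (nchain Y Y); last exact: nchain_flag.
by apply: eq_card => s; rewrite !inE on0 andbb.
Qed.

Lemma nchain_below n (X Y : {set 'I_n}) : Y \subset X ->
  nchain X X = ('C(#|X|, #|Y|) * nchain X Y)%N.
Proof.
move=> sYX; rewrite -cards_draws.
have le_YX := subset_leq_card sYX.
apply: (sum_nchain (k := #|Y|)) => [|s Z sX sZ cZ|Z|Z].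
- by rewrite -[leqRHS]card_ord max_card.
- by rewrite (on_chain_sub sZ sX) cZ ?eqxx.
- by case/andP=> _ /eqP.
- by case/andP=> sZX /eqP cZ; rewrite !(nchainC X); apply: nchain_flag.
Qed.

Lemma nchain_above n (X Y : {set 'I_n}) : X \subset Y ->
  nchain X X = ('C(n - #|X|, #|Y| - #|X|) * nchain X Y)%N.
Proof.
move=> sXY; have le_XY := subset_leq_card sXY.
have le_Yn : (#|Y| <= n)%N by rewrite -[leqRHS]card_ord max_card.
(* Supersets of [X] are counted through their complements, which are subsets of [~: X]. *)
have -> : 'C(n - #|X|, #|Y| - #|X|) =
    #|[set Z : {set 'I_n} | (X \subset Z) && (#|Z| == #|Y|)]|.
  rewrite -bin_sub; last lia.
  rewrite -card_setC_ord -(card_imset _ (@setC_inj _)).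
  have -> : (#|~: X| - (#|Y| - #|X|) = #|~: Y|)%N by rewrite !card_setC_ord; lia.
  rewrite -cards_draws; apply: eq_card => Z; rewrite -[Z]setCK.
  rewrite (mem_imset _ _ (@setC_inj _)) !inE setCS !card_setC_ord; congr (_ && _).
  have : (#|~: Z| <= n)%N by rewrite -[leqRHS]card_ord max_card.
  by rewrite card_setC_ord; lia.
apply: (sum_nchain (k := #|Y|)) => [//|s Z sX sZ cZ|Z|Z].
- by rewrite (on_chain_sub sX sZ) cZ ?eqxx.
- by case/andP=> _ /eqP.
- by case/andP=> sXZ /eqP cZ; apply: nchain_flag.
Qed.

(** * Averaging over chains *)

Lemma sum_inj_key_le (T : finType) (S : {set T}) (key : T -> nat) a b
    (h : nat -> rat) :
  {in S &, injective key} -> {in S, forall x, a <= key x < b}%N ->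
  (forall y, 0 <= h y) -> \sum_(x in S) h (key x) <= \sum_(a <= y < b) h y.
Proof.
move=> key_inj key_ab h_ge0; rewrite -big_enum -(big_map key xpredT h).
set r := map key (enum S).
have r_uniq : uniq r.
  rewrite map_inj_in_uniq ?enum_uniq // => x y.
  by rewrite !mem_enum; apply: key_inj.
have /(perm_big _) -> : perm_eq r [seq y <- index_iota a b | y \in r].
  apply: uniq_perm; rewrite ?filter_uniq ?iota_uniq // => y.
  rewrite mem_filter mem_index_iota andb_idr // => /mapP[x].
  by rewrite mem_enum => /key_ab ? ->.
by rewrite big_filter big_mkcond /=; apply: ler_sum => y _; case: ifP.
Qed.

Lemma natr_nchain n (X : {set 'I_n}) :
  (nchain X X)%:R = n`!%:R * ('C(n, #|X|)%:R)^-1 :> rat.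
Proof.
rewrite (nchain_total X) natrM mulrAC divff ?mul1r // bin_natr_neq0 //.
by rewrite -[leqRHS]card_ord max_card.
Qed.

(** The bracket is the probability that a random chain through [X] also contains [Y]; at most one of
    its terms is nonzero, and none if the sets are incomparable. *)
Lemma nchain_le n (X Y : {set 'I_n}) :
  (nchain X Y)%:R <= (nchain X X)%:R *
    ((Y == X)%:R + (if Y \proper X then ('C(#|X|, #|Y|)%:R)^-1 else 0)
     + (if X \proper Y then ('C(n - #|X|, #|Y| - #|X|)%:R)^-1 else 0)) :> rat.
Proof.
have le_n (Z : {set 'I_n}) : (#|Z| <= n)%N by rewrite -[leqRHS]card_ord max_card.
have [->|neYX] := eqVneq Y X; first by rewrite properxx !addr0 mulr1.
have [pYX|nYX] := boolP (Y \proper X).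
  have sYX := proper_sub pYX.
  have -> : X \proper Y = false by rewrite properE sYX andbF.
  rewrite add0r addr0 (nchain_below sYX) natrM mulrAC divff ?mul1r //.
  by rewrite bin_natr_neq0 // subset_leq_card.
rewrite addr0 add0r.
have [pXY|nXY] := boolP (X \proper Y).
  have sXY := proper_sub pXY.
  rewrite (nchain_above sXY) natrM mulrAC divff ?mul1r // bin_natr_neq0 //.
  exact: leq_sub2r.
rewrite mulr0 /nchain (_ : [set s | _] = set0) ?cards0 //.
apply/setP=> s; rewrite !inE; apply/negP => /andP[sX sY].
case/orP: (leq_total #|X| #|Y|) => le_c.
  by case/negP: nXY; rewrite properEneq eq_sym neYX (on_chain_sub sX sY).
by case/negP: nYX; rewrite properEneq neYX (on_chain_sub sY sX).
Qed.

(** By injectivity of the cardinal, each level strictly below or above [X] contributes at most one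
    reciprocal. Levels above are indexed by their distance from [X]. *)
Lemma sum_nchain_le n (F : {set {set 'I_n}}) (X : {set 'I_n}) :
  {in F, forall Y : {set 'I_n}, 0 < #|Y| < n}%N ->
  X \in F ->
  {in [set Y in F | Y \proper X] &, injective (fun Y : {set 'I_n} => #|Y|)} ->
  {in [set Y in F | X \proper Y] &, injective (fun Y : {set 'I_n} => #|Y|)} ->
  (\sum_(Y in F) nchain X Y)%:R <= (nchain X X)%:R *
    (1 + inv_bin_sum #|X| + inv_bin_sum (n - #|X|)) :> rat.
Proof.
move=> F_ne XF inj_dn inj_up; rewrite natr_sum.
apply: le_trans (ler_sum _ (fun Y _ => nchain_le X Y)) _.
rewrite -mulr_sumr ler_wpM2l // !big_split /= -!big_mkcondr /=.
apply: lerD; first apply: lerD.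
- by rewrite (bigD1 X) //= eqxx big1 ?addr0 // => Y /andP[_ /negPf ->].
- have := @sum_inj_key_le _ [set Y in F | Y \proper X] (fun Y : {set 'I_n} => #|Y|)
    1 #|X| (fun y => ('C(#|X|, y)%:R)^-1).
  rewrite -/(inv_bin_sum _) => le_dn.
  rewrite (eq_bigl [in [set Y in F | Y \proper X]]) => [|Y]; last by rewrite /= inE.
  apply: le_dn => [//|Y|y]; last by rewrite invr_ge0.
  rewrite inE => /andP[/F_ne/andP[-> _]].
  exact: proper_card.
have := @sum_inj_key_le _ [set Y in F | X \proper Y]
  (fun Y : {set 'I_n} => (#|Y| - #|X|)%N) 1 (n - #|X|)
  (fun y => ('C(n - #|X|, y)%:R)^-1).
rewrite -/(inv_bin_sum _) => le_up.
rewrite (eq_bigl [in [set Y in F | X \proper Y]]) => [|Y]; last by rewrite /= inE.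
apply: le_up => [Y Z YF ZF eq_sub|Y|y]; last by rewrite invr_ge0.
  2: {
  rewrite inE => /andP[/F_ne/andP[_ ltYn] /proper_card ltXY].
  by rewrite subn_gt0 ltXY ltn_sub2r // (ltn_trans ltXY). }
apply: inj_up => //; move: YF ZF; rewrite !inE => /andP[_ /proper_card ltXY].
by case/andP=> _ /proper_card ltXZ; move: eq_sub ltXY ltXZ; lia.
Qed.

(* Chains avoiding [M] are bounded directly; a chain with [m > 0] members of
   [M] is charged [m] times its excess [f - t], since [(m-1)(f-t) >= 0]. *)
Lemma lym_middle n (F M : {set {set 'I_n}}) (t : rat) :
  M \subset F -> t <= 2 ->
  {in F, forall Y : {set 'I_n}, 0 < #|Y| < n}%N ->
  {in M, forall X : {set 'I_n},
    {in [set Y in F | Y \proper X] &, injective (fun Y : {set 'I_n} => #|Y|)}} ->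
  {in M, forall X : {set 'I_n},
    {in [set Y in F | X \proper Y] &, injective (fun Y : {set 'I_n} => #|Y|)}} ->
  (forall s, {in M, forall X : {set 'I_n}, ~~ on_chain s X} ->
     #|[set X in F | on_chain s X]|%:R <= t) ->
  (forall x y, (0 < x)%N -> (0 < y)%N -> (x + y)%N = n ->
     inv_bin_sum x + inv_bin_sum y <= t - 1) ->
  \sum_(X in F) ('C(n, #|X|)%:R)^-1 <= t.
Proof.
move=> sMF t_le2 F_ne inj_dn inj_up avoid gxy.
pose f s : rat := #|[set X in F | on_chain s X]|%:R.
have fE P : \sum_(s | P s) f s
    = (\sum_(Y in F) #|[set s : 'S_n | P s && on_chain s Y]|)%:R.
  rewrite -natr_sum; congr _%:R.
  under eq_bigr do rewrite -sum1_card big_mkcond /=.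
  under [RHS]eq_bigr do rewrite -sum1_card big_mkcond /=.
  rewrite exchange_big [RHS]big_mkcond /=; apply: eq_bigr => Y _.
  rewrite big_mkcond /=; case: ifP => YF; last first.
    by apply: big1 => s _; rewrite inE YF; case: ifP.
  by apply: eq_bigr => s _; rewrite !inE YF; case: ifP.
(* Through a middle set a chain meets on average at most 1 + (t - 1) = t members of [F]. *)
have le_X X : X \in M -> \sum_(s | on_chain s X) (f s - t) <= 0.
  move=> XM; have XF := subsetP sMF _ XM; rewrite sumrB fE subr_le0.
  have -> : \sum_(s | on_chain s X) t = (nchain X X)%:R * t.
    rewrite sumr_const mulr_natl; congr (_ *+ _).
    by apply: eq_card => s; rewrite [in RHS]inE andbb.
  apply: le_trans (sum_nchain_le F_ne XF (inj_dn X XM) (inj_up X XM)) _.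
  rewrite ler_wpM2l //; have /andP[X_gt0 ltXn] := F_ne X XF.
  have := gxy #|X| (n - #|X|)%N X_gt0; rewrite subn_gt0.
  by move=> /(_ ltXn)/(_ (subnKC (ltnW ltXn))); lra.
have pt s : f s - t <= \sum_(X in M | on_chain s X) (f s - t).
  rewrite (eq_bigl [in [set X in M | on_chain s X]]) => [|X]; last by rewrite /= inE.
  rewrite sumr_const; set m := #|_|.
  have le_m : m%:R <= f s.
    rewrite ler_nat; apply: subset_leq_card; apply/subsetP=> X.
    by rewrite !inE => /andP[/(subsetP sMF) -> ->].
  have [m0|m_gt0] := posnP m.
    rewrite m0 mulr0n subr_le0; apply: avoid => X XM; apply/negP => sX.
    by have /eqP := m0; rewrite cards_eq0 => /eqP/setP/(_ X); rewrite !inE XM sX.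
  have [m1|m_gt1] := leqP m 1; first by rewrite (_ : m = 1%N) //; lia.
  (* Here f >= m >= 2 >= t, so both factors of (m - 1)(f - t) are nonnegative. *)
  rewrite -mulr_natl; have : 2 <= m%:R :> rat by rewrite ler_nat.
  move: (m%:R : rat) le_m t_le2 => x; move: (f s) => y.
  clear=> le_xy t_le2 x_ge2; rewrite -subr_ge0.
  rewrite [leRHS](_ : _ = (x - 1) * (y - t)); last by ring.
  by apply: mulr_ge0; lra.
(* Exchanging the sums distributes the total excess over the members of [M], each of which receives
   a nonpositive share by [le_X]. *)
have : \sum_(s : 'S_n) (f s - t) <= 0.
  apply: le_trans (ler_sum _ (fun s _ => pt s)) _.
  rewrite (exchange_big_dep (mem M)) //=; last by move=> s X _ /andP[].
  apply: sumr_le0 => X XM; rewrite (eq_bigl (fun s : 'S_n => on_chain s X));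
    first exact: le_X.
  by move=> s; rewrite XM.
have -> : \sum_(s : 'S_n) (f s - t) = \sum_(s : 'S_n) f s - n`!%:R * t.
  by rewrite sumrB sumr_const mulr_natl -card_Sn.
rewrite fE subr_le0 natr_sum.
rewrite (eq_bigr (fun X : {set 'I_n} => n`!%:R * ('C(n, #|X|)%:R)^-1)).
  by rewrite -mulr_sumr ler_pM2l // ltr0n fact_gt0.
move=> X _; rewrite -natr_nchain; congr _%:R; apply: eq_card => s.
by rewrite !inE andbb.
Qed.

(** * From the LYM-type inequality to a bound on the size *)

(** Give [X] the weight 1 - c2 / C(n,|X|). It is nonpositive off level k+1, and that level has at
    most c1 sets of weight 1 - c2/c1, so the total weight is at most c1 - c2. *)
Lemma lym_size n (F : {set {set 'I_n}}) k (e : rat) :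
  (forall j, j != k.+1 -> 'C(n, j) <= 'C(n, k))%N ->
  (0 < 'C(n, k))%N -> ('C(n, k) <= 'C(n, k.+1))%N ->
  \sum_(X in F) ('C(n, #|X|)%:R)^-1 <= 1 + e ->
  #|F|%:R <= 'C(n, k.+1)%:R + e * 'C(n, k)%:R.
Proof.
move=> le_k c2_gt0 le_c lym.
have c2_ge0 : 0 < 'C(n, k)%:R :> rat by rewrite ltr0n.
have c1_ge0 : 0 < 'C(n, k.+1)%:R :> rat by rewrite ltr0n (leq_trans c2_gt0).
set c1 := 'C(n, k.+1)%:R in c1_ge0 *; set c2 := 'C(n, k)%:R in c2_ge0 *.
have le_cr : c2 <= c1 by rewrite ler_nat.
have d_ge0 : 0 <= 1 - c2 / c1 by rewrite subr_ge0 ler_pdivrMr // mul1r.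
have : \sum_(X in F) (1 - c2 / 'C(n, #|X|)%:R) <= c1 - c2.
  rewrite (bigID (fun X : {set 'I_n} => #|X| == k.+1)) /=.
  apply: (@le_trans _ _ (c1 * (1 - c2 / c1) + 0)); last first.
    by rewrite addr0 mulrBr mulr1 mulrCA divff ?mulr1 // lt0r_neq0.
  apply: lerD.
    rewrite (eq_bigr (fun=> 1 - c2 / c1)) => [|X /andP[_ /eqP ->] //].
    rewrite sumr_const -mulr_natl ler_wpM2r // ler_nat.
    rewrite -[X in 'C(X, _)]card_ord -card_draws; apply: subset_leq_card.
    by apply/subsetP=> X; rewrite !inE => /andP[].
  apply: sumr_le0 => X /andP[_ nX]; rewrite subr_le0 ler_pdivlMr ?mul1r.
    by rewrite ler_nat le_k.
  by rewrite ltr0n bin_gt0 -[leqRHS]card_ord max_card.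
rewrite sumrB -mulr_sumr sumr_const -mulr_natl mulr1.
by have := ler_wpM2l (ltW c2_ge0) lym; lra.
Qed.

(** The ratio C(n,j) / C(n,j-1) = (n-j+1)/j is at least 1 as long as 2j <= n+1; for odd n this
    includes the step between the two central coefficients. *)
Lemma leq_bin_mid n i j : (i <= j)%N -> (j.*2 <= n.+1)%N -> ('C(n, i) <= 'C(n, j))%N.
Proof.
elim: j => [|j IH]; first by rewrite leqn0 => /eqP ->.
rewrite leq_eqVlt => /predU1P[-> //|]; rewrite ltnS => le_ij le_jn.
apply: leq_trans (IH le_ij _) _; first lia.
have := mul_bin_left n j; have : (j.+1 <= n - j)%N by lia.
by move: 'C(n, j) 'C(n, j.+1) (n - j)%N => x y z; nia.
Qed.

(** The excluded level is a central one. Levels below it are compared directly, levels above it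
    after the reflection j -> n - j. *)
Lemma bin_le_second n j : (1 < n)%N -> j != (uphalf (n - 2)).+1 ->
  ('C(n, j) <= 'C(n, uphalf (n - 2)))%N.
Proof.
move=> n_gt1 /eqP ne_j; have [le_j|lt_j] := leqP j (uphalf (n - 2)).
  by apply: leq_bin_mid => //; lia.
have [le_jn|lt_nj] := leqP j n; last by rewrite bin_small.
by rewrite -bin_sub //; apply: leq_bin_mid; lia.
Qed.

Lemma Sigma2E n : (1 < n)%N ->
  Sigma n 2 = ('C(n, uphalf (n - 2)) + 'C(n, (uphalf (n - 2)).+1))%N.
Proof.
move=> n_gt1; rewrite /Sigma (_ : uphalf (n + 2) = (uphalf (n - 2)).+2); last lia.
by rewrite big_nat_recr ?leqnSn //= big_nat1.
Qed.

(** * Middle sets of a family without the forbidden configuration *)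

Local Open Scope nat_scope.

Definition rank_butterfly_free n (F : {set {set 'I_n}}) : Prop :=
  ~ exists A B C D : {set 'I_n},
      [/\ A \in F, B \in F, C \in F & D \in F] /\
      uniq [:: A; B; C; D] /\
      [/\ A \subset C, A \subset D, B \subset C & B \subset D] /\
      (#|A| = #|B| \/ #|C| = #|D|).

Lemma proper_neq (T : finType) (A B : {set T}) : A \proper B -> A != B.
Proof. by rewrite properEneq => /andP[]. Qed.

Section ButterflyFree.

Variables (n : nat) (F : {set {set 'I_n}}).
Hypothesis bfF : rank_butterfly_free F.

(** Two distinct sets [A] and [B] of equal size below [X] would form the forbidden configuration
    with [X] and [C] as upper sets. *)
Lemma level_below_inj (X C A B : {set 'I_n}) :
  X \in F -> C \in F -> X \proper C -> A \in F -> B \in F ->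
  A \proper X -> B \proper X -> #|A| = #|B| -> A = B.
Proof.
move=> XF CF pXC AF BF pAX pBX eAB; apply/eqP; apply/negPn/negP => neAB.
have [pAC pBC] := (proper_trans pAX pXC, proper_trans pBX pXC).
case: bfF; exists A, B, X, C; split=> //; split; last first.
  by split; [split; apply: proper_sub | left].
by rewrite /= !inE !negb_or neAB !proper_neq.
Qed.

(** Dually, [A] and [X] would be the lower sets of a forbidden configuration. *)
Lemma level_above_inj (X A C D : {set 'I_n}) :
  X \in F -> A \in F -> A \proper X -> C \in F -> D \in F ->
  X \proper C -> X \proper D -> #|C| = #|D| -> C = D.
Proof.
move=> XF AF pAX CF DF pXC pXD eCD; apply/eqP; apply/negPn/negP => neCD.
have [pAC pAD] := (proper_trans pAX pXC, proper_trans pAX pXD).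
case: bfF; exists A, X, C, D; split=> //; split; last first.
  by split; [split; apply: proper_sub | right].
by rewrite /= !inE !negb_or neCD !proper_neq.
Qed.

Definition inner : {set {set 'I_n}} := F :\ set0 :\ setT.

(** The witnesses range over [F] rather than [inner], so the empty and the full set can make another
    set middle; [card_avoid_le1] relies on this. *)
Definition middle : {set {set 'I_n}} :=
  [set X in inner | [exists A in F, A \proper X] && [exists C in F, X \proper C]].

Lemma middle_mem X A C : X \in inner -> A \in F -> A \proper X ->
  C \in F -> X \proper C -> X \in middle.
Proof.
move=> XF AF pAX CF pXC; rewrite inE XF /=.
by apply/andP; split; apply/existsP; [exists A | exists C]; apply/andP.
Qed.

Lemma middleP X : X \in middle -> [/\ X \in F,
  exists2 A, A \in F & A \proper X & exists2 C, C \in F & X \proper C].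
Proof.
rewrite !inE => /andP[/and3P[_ _ XF] /andP[/existsP[A /andP[]] AF pA]].
by case/existsP=> C /andP[CF pC]; split=> //; [exists A | exists C].
Qed.

Lemma innerW X : X \in inner -> X \in F.
Proof. by rewrite !inE => /and3P[]. Qed.

Lemma card_inner X : X \in inner -> 0 < #|X| < n.
Proof.
rewrite !inE => /and3P[neT ne0 _]; rewrite card_gt0 ne0 /=.
by rewrite -[n in _ < n]card_ord -cardsT proper_card // properEneq neT subsetT.
Qed.

Lemma card_inner_ge : #|F| <= #|inner| + 2.
Proof.
rewrite (cardsD1 set0 F) (cardsD1 setT (F :\ set0)) addnA addnC leq_add2l.
by apply: (@leq_add _ _ 1 1); apply: leq_b1.
Qed.

Section AvoidMiddle.

Variable s : 'S_n.
Hypothesis avoid : {in middle, forall X : {set 'I_n}, ~~ on_chain s X}.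

Let S := [set X in inner | on_chain s X].

Lemma chain_comparable X Y : X \in S -> Y \in S -> X != Y ->
  X \proper Y \/ Y \proper X.
Proof.
rewrite !inE => /andP[_ sX] /andP[_ sY] neXY.
case/orP: (leq_total #|X| #|Y|) => le_c; [left | right].
  by rewrite properEneq neXY (on_chain_sub sX sY).
by rewrite properEneq eq_sym neXY (on_chain_sub sY sX).
Qed.

Lemma chain_not_middle X A C : X \in S -> A \in F -> A \proper X ->
  C \in F -> X \proper C -> False.
Proof.
rewrite inE => /andP[XF sX] AF pA CF pC.
by have /avoid := middle_mem XF AF pA CF pC; rewrite sX.
Qed.

Lemma card_avoid_le2 : #|S| <= 2.
Proof.
rewrite leqNgt; apply/negP => /card_gt2P[X [Y [Z [[XS YS ZS] [nXY nYZ nZX]]]]].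
have SF W : W \in S -> W \in F by rewrite inE => /andP[/innerW].
have [XF YF ZF] := And3 (SF _ XS) (SF _ YS) (SF _ ZS).
(* Every orientation of the three comparisons, the two cyclic ones included, puts one set strictly
   between the other two. *)
case: (chain_comparable XS YS nXY) (chain_comparable YS ZS nYZ)
  (chain_comparable ZS XS nZX) => pXY [] pYZ [] pZX;
  by [apply: (chain_not_middle YS XF _ ZF) | apply: (chain_not_middle YS ZF _ XF)
     |apply: (chain_not_middle XS YF _ ZF) | apply: (chain_not_middle XS ZF _ YF)
     |apply: (chain_not_middle ZS XF _ YF) | apply: (chain_not_middle ZS YF _ XF)].
Qed.

(** If two inner sets lay on the chain, the empty set in [F] would make the smaller one middle, or
    the full set in [F] the larger one. *)
Lemma card_avoid_le1 : (set0 \in F) || (setT \in F) -> #|S| <= 1.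
Proof.
move=> ext; rewrite leqNgt; apply/negP => /card_gt1P[X [Y [XS YS nXY]]].
suff no_lt A B : A \in S -> B \in S -> A \proper B -> False.
  by case: (chain_comparable XS YS nXY) => ?; [apply: (no_lt X Y)|apply: (no_lt Y X)].
move=> AS BS pAB; have := AS; have := BS; rewrite inE => /andP[BF _].
rewrite inE => /andP[AF _].
case/orP: ext => eF.
  apply: (chain_not_middle AS eF _ (innerW BF) pAB).
  by have /andP[] := card_inner AF; rewrite card_gt0 proper0.
apply: (chain_not_middle BS (innerW AF) pAB eF).
by move: BF; rewrite !inE properEneq subsetT andbT => /andP[].
Qed.

End AvoidMiddle.

Lemma inner_lym : 13 <= n ->
  (\sum_(X in inner) ('C(n, #|X|)%:R)^-1 <=
   if (set0 \in F) || (setT \in F) then 1 + 99 / 100 else 1 + 1 :> rat)%R.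
Proof.
move=> n_ge13; apply: (@lym_middle _ _ middle).
- by apply/subsetP=> X; rewrite inE => /andP[].
- by case: ifP => _; lra.
- by move=> X; apply: card_inner.
- move=> X /middleP[XF _ [C CF pXC]] A B; rewrite inE => /andP[/innerW AF pA].
  by rewrite inE => /andP[/innerW BF pB]; apply: (level_below_inj XF CF pXC).
- move=> X /middleP[XF [A AF pAX] _] C D; rewrite inE => /andP[/innerW CF pC].
  by rewrite inE => /andP[/innerW DF pD]; apply: (level_above_inj XF AF pAX).
- move=> s avoid; case: ifP => ext.
    by have := card_avoid_le1 avoid ext; rewrite -(ler_nat rat); lra.
  by have := card_avoid_le2 avoid; rewrite -(ler_nat rat); lra.
(* The bound 99/100 equals t - 1 in the case of a discarded set, and is below t - 1 = 1 in the
   other. *)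
move=> x y x0 y0 xy; have := inv_bin_sum_pair x0 y0; rewrite xy => /(_ n_ge13).
by case: ifP => _; lra.
Qed.

End ButterflyFree.

(** * The size bound *)

Theorem theorem2p16 (n : nat) (hn : 13 <= n) (F : {set {set 'I_n}})
  (hF : ~ exists A B C D : {set 'I_n},
      [/\ A \in F, B \in F, C \in F & D \in F] /\
      uniq [:: A; B; C; D] /\
      [/\ A \subset C, A \subset D, B \subset C & B \subset D] /\
      (#|A| = #|B| \/ #|C| = #|D|)) :
  #|F| <= Sigma n 2.
Proof.
rewrite Sigma2E; last exact: leq_trans hn.
set k := uphalf (n - 2).
have n_gt1 : 1 < n by apply: leq_trans hn.
(* 286 = C(13,3); any lower bound of at least 200 would do, since a hundredth of C(n,k) has to pay
   for two discarded sets. *)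
have c2_ge : 286 <= 'C(n, k).
  apply: (@leq_trans 'C(n, 3)); first exact: (leq_bin2l 3 hn).
  by apply: leq_bin_mid; rewrite /k; lia.
have le_c : 'C(n, k) <= 'C(n, k.+1) by apply: leq_bin_mid; rewrite /k; lia.
have size_le e := @lym_size n (inner F) k e (fun j => @bin_le_second n j n_gt1)
  (leq_trans (isT : 0 < 286) c2_ge) le_c.
have := inner_lym hF hn; case: ifP => [_|/norP[n0 nT]] /size_le le_in.
  apply: leq_trans (card_inner_ge F) _.
  rewrite -(ler_nat rat) !natrD.
  have : (286 <= 'C(n, k)%:R :> rat)%R by rewrite ler_nat.
  lra.
(* Nothing was discarded, so the LYM bound 1 + 1 applies to [F] itself. *)
have <- : inner F = F.
  apply/setP=> X; rewrite !inE; have [->|] := eqVneq X setT.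
    by rewrite (negPf nT).
  by have [->|] := eqVneq X set0; first rewrite (negPf n0).
by move: le_in; rewrite mul1r addnC -natrD ler_nat.
Qed.
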